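(* Let $(M,\omega,\nabla)$ be a Fedosov manifold equipped with a homogeneous structure $S$, and let $\tilde T$ be the torsion of $\tilde\nabla=\nabla-S$. (i) If $S\in\mathcal S_1$, then $\tilde T$ belongs to $\tilde{\mathcal T}_1$. (ii) If $S\in\mathcal S_2$, then $\tilde T$ belongs to $\tilde{\mathcal T}_2$. (iii) If $S\in\mathcal S_3$, then $\tilde T$ vanishes, and $(M,\omega,\tilde\nabla)$ is a Fedosov manifold with parallel curvature.
   Context: A Fedosov manifold $(M,\omega,\nabla)$, $\dim M=2n$, is a symplectic manifold $(M,\omega)$ with a torsion-free linear connection $\nabla$ such that $\nabla\omega=0$. A homogeneous structure is a $(1,2)$-tensor field $S$ such that, for $\tilde\nabla=\nabla-S$, one has $\tilde\nabla R=0$, $\tilde\nabla S=0$, $\tilde\nabla\omega=0$, where $R$ is the curvature of $\nabla$. ''Parallel curvature'' in (iii) means that the curvature $\tilde R$ of $\tilde\nabla$ satisfies $\tilde\nabla\tilde R=0$. Write $\omega_{XY}=\omega(X,Y)$, $S_{XYZ}=\omega(S_ZX,Y)$ (which satisfies $S_{XYZ}=S_{YXZ}$) and $\tilde T_{XYZ}=\omega(\tilde T_XY,Z)$. For a symplectic basis $\{e_1,\dots,e_{2n}\}$ of a tangent space ($\omega(e_i,e_{j+n})=\delta_{ij}$, $\omega(e_i,e_j)=\omega(e_{i+n},e_{j+n})=0$) put $\mathrm s_{13}(S)(Z)=\sum_{i=1}^n(S_{e_iZe_{i+n}}-S_{e_{i+n}Ze_i})$ and $\mathrm t_{12}(\tilde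 T)(Z)=\sum_{i=1}^n\tilde T_{e_ie_{i+n}Z}$. The classes are defined by the following conditions, holding for all $X,Y,Z$: $S\in\mathcal S_1$: $S_{XYZ}=\omega_{ZY}\omega_{XU}+\omega_{ZX}\omega_{YU}$ for some vector field $U$. $S\in\mathcal S_2$: $S_{XYZ}+S_{YZX}+S_{ZXY}=0$ and $\mathrm s_{13}(S)=0$. $S\in\mathcal S_3$: $S_{XYZ}=S_{XZY}$. $\tilde T\in\tilde{\mathcal T}_1$: $\tilde T_{XYZ}=2\omega_{XY}\omega_{ZU}+\omega_{XZ}\omega_{YU}-\omega_{YZ}\omega_{XU}$ for some vector field $U$. $\tilde T\in\tilde{\mathcal T}_2$: $\tilde T_{XYZ}+\tilde T_{YZX}+\tilde T_{ZXY}=0$ and $\mathrm t_{12}(\tilde T)=0$. *)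

(* Defs.v *)
From HB Require Import structures.
From mathcomp Require Import all_boot all_order all_algebra.
From mathcomp Require Import all_classical all_reals all_analysis.
From mathcomp Require Import ring.
Import numFieldNormedType.Exports.
Import Order.TTheory GRing.Theory Num.Theory.

Set Implicit Arguments.
Unset Strict Implicit.
Unset Printing Implicit Defensive.

Local Open Scope classical_set_scope.
Local Open Scope ring_scope.

Section smooth_on.
Context {R : realType} {m : nat}.
Implicit Types (U : set 'rV[R]_m) (f g : 'rV[R]_m -> R).

(* f is of class C^k on the open set U: all iterated partial derivatives of
   order at most k exist and are continuous at the points of U. *)
Fixpoint Ck_on (k : nat) U f : Prop :=
  (forall x, U x -> {for x, continuous f}) /\
  if k is k'.+1 then
    forall i : 'I_m, (forall x, U x -> derivable f x (delta_mx 0 i)) /\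
                     Ck_on k' U (fun x => 'D_(delta_mx 0 i) f x)
  else True.

Definition smooth_on U f := forall k, Ck_on k U f.

Lemma Ck_on_continuous k U f x : Ck_on k U f -> U x -> {for x, continuous f}.
Proof. by case: k => [|k] [cf _]; exact: cf. Qed.

Lemma Ck_onW k U f : Ck_on k.+1 U f -> Ck_on k U f.
Proof.
elim: k f => [|k IH] f [cf df]; first by split.
by split=> // i; have [dfi Df] := df i; split=> //; exact: IH.
Qed.

Lemma Ck_on_eq k U f g : open U -> {in U, f =1 g} -> Ck_on k U f -> Ck_on k U g.
Proof.
move=> oU.
have near_eq (u v : 'rV[R]_m -> R) x :
    {in U, u =1 v} -> U x -> \near x, u x = v x.
  move=> uv Ux; have := open_nbhs_nbhs (conj oU Ux).
  by apply: filterS => y Uy; apply: uv; rewrite inE.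
have eq_cont (u v : 'rV[R]_m -> R) x :
    {in U, u =1 v} -> U x -> {for x, continuous u} -> {for x, continuous v}.
  move=> uv Ux; rewrite /prop_for /continuous_at (uv x) ?inE// => ux.
  apply: cvg_trans ux; apply: near_eq_cvg; first exact: (nbhs_filter x).
  exact: near_eq uv Ux.
elim: k f g => [|k IH] f g fg [cf df].
  by split=> // x Ux; exact: eq_cont (cf x Ux).
split.
- by move=> x Ux; exact: eq_cont (cf x Ux).
- move=> i; have [dfi Df] := df i; split.
    by move=> x Ux; apply: near_eq_derivable (dfi x Ux); exact: near_eq.
  by apply: IH Df => x; rewrite inE => Ux; apply: near_eq_derive; exact: near_eq.
Qed.

Lemma Ck_on_cst k U (a : R) : Ck_on k U (cst a).
Proof.
elim: k a => [|k IH] a.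
  by split=> // x _; exact: cst_continuous.
split=> [x _|i]; first exact: cst_continuous.
split=> [x _|]; first exact: derivable_cst.
suff -> : (fun x => 'D_(delta_mx 0 i) (cst a : 'rV[R]_m -> R) x) = cst 0 by [].
by apply/funext => x; rewrite derive_cst.
Qed.

Lemma Ck_onD k U f g : open U -> Ck_on k U f -> Ck_on k U g ->
  Ck_on k U (f + g).
Proof.
move=> oU; elim: k f g => [|k IH] f g [cf df] [cg dg].
  by split=> // x Ux; apply: continuousD; [exact: cf|exact: cg].
split=> [x Ux|i]; first by apply: continuousD; [exact: cf|exact: cg].
  have [dfi Df] := df i; have [dgi Dg] := dg i; split.
    by move=> x Ux; apply: derivableD; [exact: dfi|exact: dgi].
  apply: Ck_on_eq (IH _ _ Df Dg) => // x; rewrite inE => Ux.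
  by rewrite [RHS]deriveD; [|exact: dfi|exact: dgi].
Qed.

Lemma Ck_onM k U f g : open U -> Ck_on k U f -> Ck_on k U g ->
  Ck_on k U (f * g).
Proof.
move=> oU; have Mc k' u v x : Ck_on k' U u -> Ck_on k' U v -> U x ->
    {for x, continuous (u * v)}.
  by move=> Cu Cv Ux; apply: continuousM;
    [exact: Ck_on_continuous Cu Ux|exact: Ck_on_continuous Cv Ux].
elim: k f g => [|k IH] f g Cf Cg.
  by split=> // x Ux; exact: Mc Cf Cg Ux.
split=> [x Ux|i]; first exact: Mc Cf Cg Ux.
  have [dfi Df] := Cf.2 i; have [dgi Dg] := Cg.2 i; split.
    by move=> x Ux; apply: derivableM; [exact: dfi|exact: dgi].
  have := Ck_onD oU (IH _ _ (Ck_onW Cf) Dg) (IH _ _ (Ck_onW Cg) Df).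
  apply: Ck_on_eq => // x; rewrite inE => Ux.
  by rewrite [RHS]deriveM; [|exact: dfi|exact: dgi].
Qed.

End smooth_on.

Record chart (R : realType) (m : nat) (M : topologicalType) := Chart {
  chart_dom : set M ;
  chart_map : M -> 'rV[R]_m ;
  chart_inv : 'rV[R]_m -> M ;
  chart_dom_open : open chart_dom ;
  chart_codom_open : open (chart_map @` chart_dom) ;
  chart_mapK : forall p, chart_dom p -> chart_inv (chart_map p) = p ;
  chart_map_continuous :
    forall p, chart_dom p -> {for p, continuous chart_map} ;
  chart_inv_continuous :
    forall x, (chart_map @` chart_dom) x -> {for x, continuous chart_inv} }.

Definition chart_codom R m M (c : chart R m M) : set 'rV[R]_m :=
  chart_map c @` chart_dom c.

(* The smooth structure is the one determined by the atlas, which need not be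
   maximal. *)
Record manifold (R : realType) (m : nat) := Manifold {
  manifold_carrier :> topologicalType ;
  atlas : set (chart R m manifold_carrier) ;
  manifold_hausdorff : hausdorff_space manifold_carrier ;
  manifold_second_countable : @second_countable manifold_carrier ;
  atlas_cover :
    forall p : manifold_carrier, exists2 c, atlas c & chart_dom c p ;
  atlas_compatible : forall c d, atlas c -> atlas d -> forall i : 'I_m,
    smooth_on (chart_map c @` (chart_dom c `&` chart_dom d))
              (fun x => chart_map d (chart_inv c x) 0 i) }.

Section smooth_functions.
Context {R : realType} {m : nat} (M : manifold R m).

Definition smooth (f : M -> R) : Prop :=
  forall c, atlas c -> smooth_on (chart_codom c) (f \o chart_inv c).

Definition smooth_pred : {pred M -> R} := mem [set f | smooth f].

Record Cinfty := SmoothFun {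
  smooth_fun :> M -> R ;
  _ : smooth_fun \in smooth_pred }.

HB.instance Definition _ := [isSub for smooth_fun].
HB.instance Definition _ := [Choice of Cinfty by <:].

Lemma smooth_predP f : reflect (smooth f) (f \in smooth_pred).
Proof. by apply: (iffP idP); rewrite inE. Qed.

Lemma smooth_cst a : cst a \in smooth_pred.
Proof. by apply/smooth_predP => c _ k; exact: Ck_on_cst. Qed.

Lemma smoothD f g : f \in smooth_pred -> g \in smooth_pred ->
  f + g \in smooth_pred.
Proof.
move=> /smooth_predP sf /smooth_predP sg; apply/smooth_predP => c ac k.
by apply: (Ck_onD _ (sf c ac k) (sg c ac k)); exact: chart_codom_open.
Qed.

Lemma smoothM f g : f \in smooth_pred -> g \in smooth_pred ->
  f * g \in smooth_pred.
Proof.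
move=> /smooth_predP sf /smooth_predP sg; apply/smooth_predP => c ac k.
by apply: (Ck_onM _ (sf c ac k) (sg c ac k)); exact: chart_codom_open.
Qed.

Lemma smoothZ (a : R) (f : M -> R) : f \in smooth_pred ->
  a *: f \in smooth_pred.
Proof.
move=> sf; rewrite (_ : a *: f = cst a * f); last exact/funext.
by apply: smoothM => //; exact: smooth_cst.
Qed.

Lemma smooth_subring_closed : subring_closed smooth_pred.
Proof.
split; [exact: smooth_cst| |exact: smoothM].
by move=> f g sf sg; rewrite -scaleN1r smoothD ?smoothZ.
Qed.

HB.instance Definition _ :=
  GRing.isSubringClosed.Build (M -> R) smooth_pred smooth_subring_closed.

HB.instance Definition _ :=
  GRing.isScaleClosed.Build R (M -> R) smooth_pred smoothZ.

HB.instance Definition _ :=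
  GRing.SubChoice_isSubComPzRing.Build _ _ Cinfty smooth_subring_closed.
HB.instance Definition _ := [SubZmodule_isSubLmodule of Cinfty by <:].

End smooth_functions.

(* Vector fields are the R-linear derivations of C^oo(M), i.e. of the algebra
   [Cinfty M] of smooth functions. *)

Section vector_fields.
Context {R : realType} {m : nat} (M : manifold R m).
Local Notation C := (Cinfty M).

Definition derivation (X : C -> C) : Prop :=
  (forall (a : R) (f g : C), X (a *: f + g) = a *: X f + X g) /\
  (forall f g : C, X (f * g) = f * X g + g * X f).

(* The codomain is C^o so that (f *: X) g = f * X g makes vector fields a
   module over C. *)
Definition derivation_pred : {pred C -> C^o} := mem [set X | derivation X].

Record vfield := VField {
  vfield_fun :> C -> C^o ;
  _ : vfield_fun \in derivation_pred }.

HB.instance Definition _ := [isSub for vfield_fun].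
HB.instance Definition _ := [Choice of vfield by <:].

Lemma derivation_predP (X : C -> C^o) :
  reflect (derivation X) (X \in derivation_pred).
Proof. by apply: (iffP idP); rewrite inE. Qed.

Lemma vfieldP (X : vfield) : derivation X.
Proof. by case: X => X /= /derivation_predP. Qed.

Lemma Cinfty_scaleAr (a : R) (f g : C) : a *: (f * g) = f * (a *: g).
Proof. by apply/val_inj/funext => p /=; exact: mulrCA. Qed.

Lemma derivation_submod_closed : submod_closed derivation_pred.
Proof.
split.
  apply/derivation_predP; split=> [a f g|f g] /=.
    change (0 = a *: 0 + 0 :> C); by rewrite addr0 scaler0.
  change (0 = f * 0 + g * 0 :> C); by rewrite !mulr0 addr0.
move=> h X Y /derivation_predP[Xl XL] /derivation_predP[Yl YL].
apply/derivation_predP; split=> [a f g|f g] /=.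
  change (h * X (a *: f + g) + Y (a *: f + g) =
          a *: (h * X f + Y f) + (h * X g + Y g)).
  by rewrite Xl Yl mulrDr scalerDr Cinfty_scaleAr addrACA.
change (h * X (f * g) + Y (f * g) =
        f * (h * X g + Y g) + g * (h * X f + Y f)).
by rewrite XL YL !mulrDr !(mulrCA h) addrACA.
Qed.

HB.instance Definition _ :=
  GRing.isSubmodClosed.Build C (C -> C^o) derivation_pred
    derivation_submod_closed.

HB.instance Definition _ := [SubChoice_isSubLmodule of vfield by <:].

Lemma lie_derivation (X Y : vfield) :
  (fun f : C => X (Y f) - Y (X f)) \in derivation_pred.
Proof.
have [Xl XL] := vfieldP X; have [Yl YL] := vfieldP Y.
have XD f g : X (f + g) = X f + X g by have := Xl 1 f g; rewrite !scale1r.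
have YD f g : Y (f + g) = Y f + Y g by have := Yl 1 f g; rewrite !scale1r.
apply/derivation_predP; split=> [a f g|f g].
  by rewrite Yl Xl Xl Yl scalerBr opprD addrACA.
rewrite YL XL XD YD !XL !YL.
ring.
Qed.

End vector_fields.

Definition lie_bracket {R : realType} {m : nat} {M : manifold R m}
  (X Y : vfield M) : vfield M := VField (lie_derivation X Y).

Section tangent_vectors.
Context {R : realType} {m : nat} {M : manifold R m}.
Local Notation C := (Cinfty M).

Definition tangent_vector (p : M) (v : C -> R) : Prop :=
  (forall (a : R) (f g : C), v (a *: f + g) = a * v f + v g) /\
  (forall f g : C, v (f * g) = f p * v g + g p * v f).

Definition vfield_at (X : vfield M) (p : M) : C -> R :=
  fun f => (X f : C) p.

End tangent_vectors.

(* Tensor fields are C^oo(M)-multilinear maps on vector fields; for the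
   (1,2)-tensor field S, [S X Y] stands for S_X Y. *)

Section geometry.
Context {R : realType} {m : nat} {M : manifold R m}.
Local Notation C := (Cinfty M).
Local Notation XM := (vfield M).

Definition tensorial2 (V : lmodType C) (B : XM -> XM -> V) : Prop :=
  (forall Y, linear (fun X => B X Y)) /\ (forall X, linear (B X)).

Definition linear_connection (nabla : XM -> XM -> XM) : Prop :=
  [/\ forall Y, linear (fun X => nabla X Y),
      forall X Y Z, nabla X (Y + Z) = nabla X Y + nabla X Z &
      forall X (f : C) Y, nabla X (f *: Y) = (X f : C) *: Y + f *: nabla X Y].

Definition torsion (nabla : XM -> XM -> XM) (X Y : XM) : XM :=
  nabla X Y - nabla Y X - lie_bracket X Y.

Definition curvature (nabla : XM -> XM -> XM) (X Y Z : XM) : XM :=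
  nabla X (nabla Y Z) - nabla Y (nabla X Z) - nabla (lie_bracket X Y) Z.

Definition parallel_form (nabla : XM -> XM -> XM) (omega : XM -> XM -> C) :=
  forall W X Y : XM,
    (W (omega X Y) : C) - omega (nabla W X) Y - omega X (nabla W Y) = 0.

Definition parallel_tensor12 (nabla S : XM -> XM -> XM) :=
  forall W X Y : XM,
    nabla W (S X Y) - S (nabla W X) Y - S X (nabla W Y) = 0.

Definition parallel_tensor13 (nabla : XM -> XM -> XM)
    (Q : XM -> XM -> XM -> XM) :=
  forall W X Y Z : XM,
    nabla W (Q X Y Z) - Q (nabla W X) Y Z - Q X (nabla W Y) Z
      - Q X Y (nabla W Z) = 0.

Definition closed_form (omega : XM -> XM -> C) : Prop :=
  forall X Y Z : XM,
    (X (omega Y Z) : C) - (Y (omega X Z) : C) + (Z (omega X Y) : C)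
    - omega (lie_bracket X Y) Z + omega (lie_bracket X Z) Y
    - omega (lie_bracket Y Z) X = 0.

(* Nondegeneracy is pointwise: if omega_p(X_p, -) vanishes then X_p = 0. *)
Definition symplectic_form (omega : XM -> XM -> C) : Prop :=
  [/\ @tensorial2 C^o omega,
      forall X, omega X X = 0,
      forall (p : M) X, (forall Y, omega X Y p = 0) -> vfield_at X p = 0 &
      closed_form omega].

Definition fedosov (omega : XM -> XM -> C) (nabla : XM -> XM -> XM) : Prop :=
  [/\ symplectic_form omega,
      linear_connection nabla,
      forall X Y, torsion nabla X Y = 0 &
      parallel_form nabla omega].

Definition sub_connection (nabla S : XM -> XM -> XM) : XM -> XM -> XM :=
  fun X Y => nabla X Y - S X Y.

Definition homogeneous_structure (omega : XM -> XM -> C)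
    (nabla S : XM -> XM -> XM) : Prop :=
  let nabla' := sub_connection nabla S in
  [/\ @tensorial2 XM S,
      parallel_tensor13 nabla' (curvature nabla),
      parallel_tensor12 nabla' S &
      parallel_form nabla' omega].

End geometry.

Section classes.
Context {R : realType} {n : nat} {M : manifold R (n + n)}.
Local Notation C := (Cinfty M).
Local Notation XM := (vfield M).
Variable omega : XM -> XM -> C.

(* S_{XYZ} = omega(S_Z X, Y): the third slot is the direction. *)
Definition lower_S (S : XM -> XM -> XM) (X Y Z : XM) : C := omega (S Z X) Y.
Definition lower_T (T : XM -> XM -> XM) (X Y Z : XM) : C := omega (T X Y) Z.

(* A symplectic basis of T_p M is given through vector fields e_i taking these
   values at p: contractions of tensor fields at p do not depend on the
   chosen extension.  [e (lshift n i)] is e_i and [e (rshift n i)] is e_{i+n}. *)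
Definition symplectic_basis_at (p : M) (e : 'I_(n + n) -> XM) : Prop :=
  [/\ forall v, tangent_vector p v ->
        exists! c : 'rV[R]_(n + n),
          forall f : C, v f = \sum_i c 0 i * vfield_at (e i) p f,
      forall i j : 'I_n,
        omega (e (lshift n i)) (e (rshift n j)) p = (i == j)%:R,
      forall i j : 'I_n, omega (e (lshift n i)) (e (lshift n j)) p = 0 &
      forall i j : 'I_n, omega (e (rshift n i)) (e (rshift n j)) p = 0].

Definition s13 (S : XM -> XM -> XM) (p : M) (e : 'I_(n + n) -> XM) (Z : XM)
    : R :=
  \sum_(i < n) (lower_S S (e (lshift n i)) Z (e (rshift n i)) p
              - lower_S S (e (rshift n i)) Z (e (lshift n i)) p).

Definition t12 (T : XM -> XM -> XM) (p : M) (e : 'I_(n + n) -> XM) (Z : XM)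
    : R :=
  \sum_(i < n) lower_T T (e (lshift n i)) (e (rshift n i)) Z p.

Definition class_S1 (S : XM -> XM -> XM) : Prop :=
  exists U : XM, forall X Y Z : XM,
    lower_S S X Y Z = omega Z Y * omega X U + omega Z X * omega Y U.

Definition class_S2 (S : XM -> XM -> XM) : Prop :=
  (forall X Y Z : XM, lower_S S X Y Z + lower_S S Y Z X + lower_S S Z X Y = 0)
  /\ (forall p e, symplectic_basis_at p e -> forall Z, s13 S p e Z = 0).

Definition class_S3 (S : XM -> XM -> XM) : Prop :=
  forall X Y Z : XM, lower_S S X Y Z = lower_S S X Z Y.

Definition class_T1 (T : XM -> XM -> XM) : Prop :=
  exists U : XM, forall X Y Z : XM,
    lower_T T X Y Z = 2 * (omega X Y * omega Z U)
      + omega X Z * omega Y U - omega Y Z * omega X U.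

Definition class_T2 (T : XM -> XM -> XM) : Prop :=
  (forall X Y Z : XM, lower_T T X Y Z + lower_T T Y Z X + lower_T T Z X Y = 0)
  /\ (forall p e, symplectic_basis_at p e -> forall Z, t12 T p e Z = 0).

End classes.

(* Main.v *)
(** Write D = nabla - S. Since nabla is torsion-free, the torsion of D is
    T'(X, Y) = S_Y X - S_X Y, that is T'_{XYZ} = S_{XZY} - S_{YZX}. As D and
    nabla both preserve omega, S_{XYZ} is symmetric in X and Y; (i), (ii) and the
    vanishing in (iii) then follow by inspection, the last one by nondegeneracy
    of omega. Finally D S = 0 gives
    R'(X, Y) = R(X, Y) - [S_X, S_Y] - S_{T'(X, Y)}, and when T' = 0 the right-hand
    side is built from the D-parallel tensors R and S only. *)

Require Import Defs.
From mathcomp Require Import all_boot all_order all_algebra.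
From mathcomp Require Import all_classical all_reals all_analysis.
From mathcomp Require Import ring.
Import GRing.Theory.
Local Open Scope ring_scope.

Section linear_facts.
Context {A : pzRingType} {V W : lmodType A} {f : V -> W}.
Hypothesis fl : linear f.

Lemma linear_fD u v : f (u + v) = f u + f v.
Proof. by rewrite -[u in LHS]scale1r fl scale1r. Qed.

Lemma linear_fB u v : f (u - v) = f u - f v.
Proof. by rewrite addrC -scaleN1r fl scaleN1r addrC. Qed.

Lemma linear_f0 : f 0 = 0.
Proof. by rewrite -(subrr 0) linear_fB subrr. Qed.

Lemma linear_fZ a u : f (a *: u) = a *: f u.
Proof. by rewrite -[a *: u]addr0 fl linear_f0 addr0. Qed.

End linear_facts.

Section vector_field_facts.
Context {R : realType} {m : nat} {M : manifold R m}.
Local Notation C := (Cinfty M).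
Implicit Types X Y Z U : vfield M.

Lemma vfield_ext X Y : (forall f : C, (X f : C) = Y f) -> X = Y.
Proof. by move=> XY; apply/val_inj/funext => f; exact: XY. Qed.

Lemma vfieldDE X Y (f : C) : ((X + Y) f : C) = (X f : C) + (Y f : C).
Proof. by []. Qed.

Lemma vfieldNE X (f : C) : ((- X) f : C) = - (X f : C).
Proof. by []. Qed.

Lemma vfield_at_eq0 X : (forall p, vfield_at X p = 0) -> X = 0.
Proof.
move=> X0; apply: vfield_ext => f; apply/val_inj/funext => p.
exact: (congr1 (fun v => v f) (X0 p)).
Qed.

End vector_field_facts.

(* Additive identities between vector fields are checked on functions, where
   [ring] applies. *)
Ltac vfield_abel :=
  let f := fresh "f" in
  apply: vfield_ext => f; rewrite ?(vfieldDE, vfieldNE); ring.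

Section connections.
Context {R : realType} {m : nat} {M : manifold R m}.
Implicit Types (X Y Z W : vfield M) (omega : vfield M -> vfield M -> Cinfty M).
Implicit Types nabla S : vfield M -> vfield M -> vfield M.

Lemma symplectic_nondegenerate omega X :
  symplectic_form omega -> (forall Y, omega X Y = 0) -> X = 0.
Proof.
move=> [_ _ nd _] X0; apply: vfield_at_eq0 => p; apply: nd => Y.
by rewrite X0.
Qed.

(** Since [S X] is linear over functions, subtracting it leaves the derivative term of the Leibniz
    rule unchanged. *)
Lemma sub_linear_connection nabla S :
  linear_connection nabla -> @tensorial2 _ _ M (vfield M) S ->
  linear_connection (sub_connection nabla S).
Proof.
move=> [nl nD nL] [Sl Sr]; rewrite /sub_connection; split.
- by move=> Y f X X'; rewrite nl Sl scalerBr opprD addrACA.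
- by move=> X Y Z; rewrite nD (linear_fD (Sr X)) opprD addrACA.
- by move=> X f Y; rewrite nL (linear_fZ (Sr X)) scalerBr addrA.
Qed.

Lemma torsion_sub_connection nabla S X Y :
  torsion nabla X Y = 0 ->
  torsion (sub_connection nabla S) X Y = S Y X - S X Y.
Proof.
(* Writing the added zero as the torsion of [nabla] lets the Lie brackets cancel. *)
move=> T0; rewrite -[RHS]addr0 -T0 /torsion /sub_connection.
vfield_abel.
Qed.

(** [nabla X] is additive but not linear over functions, so [linear_fB] does not apply to it. *)
Lemma linear_connectionB nabla X Y Z :
  linear_connection nabla -> nabla X (Y - Z) = nabla X Y - nabla X Z.
Proof.
by case=> _ nD _; rewrite -{2}(subrK Z Y) (nD X (Y - Z)) addrK.
Qed.

(** Expand the curvature of [nabla = D + S]. By [D S = 0], the term [D X (S Y Z)] is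
    [S (D X Y) Z + S Y (D X Z)]. After antisymmetrising in [X] and [Y], the terms [S Y (D X Z)]
    cancel the other mixed ones, and [S (D X Y) Z] combines with the bracket term into the
    torsion. *)
Lemma curvature_sub_connection nabla S X Y Z :
  linear_connection nabla -> @tensorial2 _ _ M (vfield M) S ->
  parallel_tensor12 (sub_connection nabla S) S ->
  curvature (sub_connection nabla S) X Y Z =
  curvature nabla X Y Z - (S X (S Y Z) - S Y (S X Z))
    - S (torsion (sub_connection nabla S) X Y) Z.
Proof.
move=> nC [Sl Sr] Spar.
have SX := Spar X Y Z; have SY := Spar Y X Z.
rewrite /torsion /curvature.
set D := sub_connection nabla S in SX SY *.
have nE U V : nabla U V = D U V + S U V by rewrite subrK.
have DC : linear_connection D by exact: sub_linear_connection.
have DD U V V' : D U (V + V') = D U V + D U V' by have [_ ->] := DC.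
(* Once [D] is an independent symbol, [nE] eliminates [nabla] in its favour and only an additive
   identity remains. *)
clearbody D; rewrite !(linear_fB (Sl Z)) !nE !DD !(linear_fD (Sr _)).
move/eqP: SX; rewrite -addrA -opprD subr_eq0 => /eqP ->.
move/eqP: SY; rewrite -addrA -opprD subr_eq0 => /eqP ->.
vfield_abel.
Qed.

Lemma parallel_curvature_sub_connection nabla S :
  linear_connection nabla -> @tensorial2 _ _ M (vfield M) S ->
  parallel_tensor13 (sub_connection nabla S) (curvature nabla) ->
  parallel_tensor12 (sub_connection nabla S) S ->
  (forall X Y, torsion (sub_connection nabla S) X Y = 0) ->
  parallel_tensor13 (sub_connection nabla S)
    (curvature (sub_connection nabla S)).
Proof.
move=> nC St Rpar Spar T0 W X Y Z.
have [Sl Sr] := St.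
have R'E U V V' : curvature (sub_connection nabla S) U V V' =
    curvature nabla U V V' - (S U (S V V') - S V (S U V')).
  by rewrite curvature_sub_connection // T0 (linear_f0 (Sl _)) subr0.
have DC := sub_linear_connection _ _ nC St.
have := Rpar W X Y Z; rewrite !R'E !(linear_connectionB _ _ _ _ DC).
set D := sub_connection nabla S in Spar DC *.
have DS U V V' : D U (S V V') = S (D U V) V' + S V (D U V').
  by apply/eqP; rewrite -subr_eq0 opprD addrA Spar.
(* By [DS], used twice, [D W] acts on the products [S U (S V V')] as a derivation; all quadratic
   terms cancel and [D R = 0] is left. *)
clearbody D; rewrite !DS !(linear_fD (Sr _)) => R0; rewrite -[RHS]R0.
vfield_abel.
Qed.

End connections.

Section lowered_tensors.
Context {R : realType} {n : nat} {M : manifold R (n + n)}.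
Context {omega : vfield M -> vfield M -> Cinfty M}.
Context {nabla S : vfield M -> vfield M -> vfield M}.
Hypothesis fed : fedosov omega nabla.
Hypothesis hom : homogeneous_structure omega nabla S.

Let T' := torsion (sub_connection nabla S).

Lemma fedosov_antisym X Y : omega X Y = - omega Y X.
Proof.
have [[[ol or_] alt _ _] _ _ _] := fed.
apply/eqP; rewrite -addr_eq0; apply/eqP.
have := alt (X + Y); rewrite (linear_fD (ol _)) !(linear_fD (or_ _)) !alt.
by rewrite add0r addr0.
Qed.

(** The difference of the two parallelism conditions puts each [S Z] in the symplectic Lie algebra:
    [omega (S Z X) Y + omega X (S Z Y) = 0]. *)
Lemma lower_S_sym X Y Z : lower_S omega S X Y Z = lower_S omega S Y X Z.
Proof.
have [[[ol or_] _ _ _] _ _ npar] := fed; have [_ _ _ dpar] := hom.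
have := dpar Z X Y; rewrite /sub_connection (linear_fB (ol _)) (linear_fB (or_ _)).
rewrite /lower_S (fedosov_antisym (S Z Y)) => d0.
rewrite -[LHS]addr0 -(npar Z X Y) -[RHS]addr0 -d0; ring.
Qed.

Lemma lower_torsion X Y Z :
  lower_T omega T' X Y Z = lower_S omega S X Z Y - lower_S omega S Y Z X.
Proof.
have [[[ol _] _ _ _] _ T0 _] := fed.
by rewrite /lower_T /T' torsion_sub_connection // (linear_fB (ol _)).
Qed.

Lemma class_S1_torsion : class_S1 omega S -> class_T1 omega T'.
Proof.
have [[[_ or_] _ _ _] _ _ _] := fed.
(* Substituting [SU] in [lower_torsion] gives the pattern of [class_T1] for [U] with the opposite
   sign. *)
move=> [U SU]; exists (- U) => X Y Z; rewrite lower_torsion !SU.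
have oN V : omega V (- U) = - omega V U.
  by rewrite -[- U]sub0r -(subrr U) !(linear_fB (or_ _)); ring.
rewrite !oN (fedosov_antisym Y X); ring.
Qed.

Lemma class_S2_torsion : class_S2 omega S -> class_T2 omega T'.
Proof.
move=> [_ tr0]; split=> [X Y Z|p e be Z].
  (* The six terms of the cyclic sum cancel in pairs, by symmetry in the first two slots. *)
  rewrite !lower_torsion (lower_S_sym Z X) (lower_S_sym Y X) (lower_S_sym Z Y).
  ring.
(* The traces [t12] of the torsion and [s13] of [S] agree summand by summand. *)
by rewrite -[RHS](tr0 p e be Z); apply: eq_bigr => i _; rewrite lower_torsion.
Qed.

(** Symmetric in slots 1, 2 and in slots 2, 3, the lowered [S] is totally symmetric, so the two
    terms of [lower_torsion] coincide. *)
Lemma class_S3_torsion : class_S3 omega S -> forall X Y, T' X Y = 0.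
Proof.
have [sf _ _ _] := fed.
move=> S3 X Y; apply: (symplectic_nondegenerate _ _ sf) => Z.
rewrite -[LHS]/(lower_T omega T' X Y Z) lower_torsion S3 (S3 Y Z X) (lower_S_sym Y X).
exact: subrr.
Qed.

End lowered_tensors.

Theorem proposition6p5 (R : realType) (n : nat) (M : manifold R (n + n))
    (omega : vfield M -> vfield M -> Cinfty M)
    (nabla S : vfield M -> vfield M -> vfield M) :
  fedosov omega nabla ->
  homogeneous_structure omega nabla S ->
  let nabla' := sub_connection nabla S in
  let T' := torsion nabla' in
  [/\ class_S1 omega S -> class_T1 omega T',
      class_S2 omega S -> class_T2 omega T' &
      class_S3 omega S ->
        [/\ forall X Y, T' X Y = 0,
            fedosov omega nabla' &
            parallel_tensor13 nabla' (curvature nabla')]].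
Proof.
move=> fed hom nabla' T'; split.
- exact: class_S1_torsion fed.
- exact: class_S2_torsion fed hom.
- move=> S3; have T0 := class_S3_torsion fed hom S3.
  have [sf nC _ _] := fed; have [St Rpar Spar opar] := hom.
  split=> //; first by split=> //; exact: sub_linear_connection.
  exact: parallel_curvature_sub_connection.
Qed.
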